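(* The finite potential little groups are exactly those finite subgroups of $SO(2)\times SO(2)$ which fall into class $\mathrm{E}_1$; that is, a subgroup $F$ of $C_n\times C_m\subset SO(2)\times SO(2)$ ($n,m$ positive even integers) is a potential little group if and only if $F$ contains $(-I,-I)$ but does not contain the whole group $D=\{(I,I),(-I,I),(I,-I),(-I,-I)\}$.
   Context: $\mathcal P=P_1(\mathbb R)\times P_1(\mathbb R)$ is the torus, with points $(x,y)$ and angular coordinates $(\rho,\sigma)$ mod $2\pi$, $x=\cot(\rho/2)$, $y=\cot(\sigma/2)$; $\mathcal H(\mathcal P)$ is the Hilbert space of real-valued functions on $\mathcal P$ square integrable for Lebesgue measure $d\rho\,d\sigma$. The group $\mathcal G=SL(2,\mathbb R)\times SL(2,\mathbb R)$ acts on $\mathcal H(\mathcal P)$ by $$(T'(g,h)\phi)(x,y)=k_g^{-3}(x)s_g(x)k_h^{-3}(y)s_h(y)\phi(xg,yh),$$ where for $g=\begin{pmatrix}a&b\\c&d\end{pmatrix}$: $xg=\frac{xa+c}{xb+d}$, $k_g(x)=\left\{\frac{(xb+d)^2+(xa+c)^2}{1+x^2}\right\}^{1/2}$, $s_g(x)=\frac{xb+d}{|xb+d|}$. $C_n=\{R(2\pi r/n):0\le r\le n-1\}\subset SO(2)$, $R(\theta)=\begin{pmatrix}\cos\theta&\sin\theta\\-\sin\theta&\cos\theta\end{pmatrix}$. Every finite subgroup of $SO(2)\times SO(2)$ is a subgroup of some $C_n\times C_m$ with $n,m$ even. For a subgroup $F$ of $SO(2)\times SO(2)$, $\mathcal H(F)=\{f\in\mathcal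 H(\mathcal P):T'(h)f=f\ \text{for all }h\in F\}$. $F$ is a potential little group if $\mathcal H(F)\neq\{0\}$ and there is no strictly larger subgroup of $SO(2)\times SO(2)$ having the same space of invariant vectors as $F$. Class $\mathrm{E}_1$ consists of the subgroups (necessarily of even order) containing $\{(I,I),(-I,-I)\}$ but not containing $D$. *)

(* Defs.v *)
From HB Require Import structures.
From mathcomp Require Import all_boot all_order all_algebra.
From mathcomp Require Import all_classical all_reals all_analysis.
From mathcomp Require Import measurable_realfun.

Set Implicit Arguments.
Unset Strict Implicit.
Unset Printing Implicit Defensive.

Import Order.TTheory GRing.Theory Num.Theory.
Import numFieldNormedType.Exports.

Local Open Scope classical_set_scope.
Local Open Scope ring_scope.

(* The real projective line R u {oo}, with oo encoded as None. *)
Definition P1 (R : realType) : Type := option R.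

Section projective_line.
Variable R : realType.

HB.instance Definition _ := Choice.copy (P1 R) (option R).
HB.instance Definition _ := isPointed.Build (P1 R) None.

(* The Borel sigma-algebra of P1: {oo} is closed and its complement is R. *)
Definition P1_measurable : set (set (P1 R)) :=
  [set A | measurable ((@Some R) @^-1` A)].

Let P1_measurable0 : P1_measurable set0.
Proof. by rewrite /P1_measurable /= preimage_set0; exact: measurable0. Qed.

Let P1_measurableC A : P1_measurable A -> P1_measurable (~` A).
Proof.
by rewrite /P1_measurable /= preimage_setC => mA; exact: measurableC.
Qed.

Let P1_measurable_bigcup (A : (set (P1 R))^nat) :
  (forall i, P1_measurable (A i)) -> P1_measurable (\bigcup_i A i).
Proof.
rewrite /P1_measurable /= preimage_bigcup => mA.
by apply: bigcup_measurable => i _; exact: mA.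
Qed.

HB.instance Definition _ := @isMeasurable.Build default_measure_display
  (P1 R) P1_measurable P1_measurable0 P1_measurableC P1_measurable_bigcup.

(* rho |-> cot (rho / 2) *)
Definition angular (rho : R) : P1 R :=
  if sin (rho / 2) == 0 then None
  else Some (cos (rho / 2) / sin (rho / 2)).

Lemma measurable_angular : measurable_fun [set: R] angular.
Proof.
have ch : continuous ( *%R^~ 2^-1 : R -> R) by exact: mulrr_continuous.
have cs : continuous (fun r : R => sin (r / 2)).
  by move=> x; exact: (cvg_comp _ _ (ch x) (@continuous_sin R (x / 2))).
have cc : continuous (fun r : R => cos (r / 2)).
  by move=> x; exact: (cvg_comp _ _ (ch x) (@continuous_cos R (x / 2))).
pose D := [set r : R | sin (r / 2) != 0].
have oD : open D.
  by move/continuousP: cs => /(_ [set x | x != 0]); apply; exact: open_neq.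
have mD : measurable D by exact: open_measurable.
have mc : measurable_fun D (fun r : R => cos (r / 2) / sin (r / 2)).
  apply: open_continuous_measurable_fun => // x; rewrite inE => Dx.
  by apply: cvgM; [exact: cc|apply: cvgV => //; exact: cs].
move=> _ A mA; rewrite setTI.
have -> : angular @^-1` A =
    (D `&` (fun r : R => cos (r / 2) / sin (r / 2)) @^-1` (@Some R @^-1` A))
    `|` (~` D `&` [set _ | A None]).
  apply/seteqP; split => r; rewrite /angular /D /=.
    case: (eqVneq (sin (r / 2)) 0) => r0 Ar; last by left.
    by right; split => //; rewrite r0 eqxx.
  case: (eqVneq (sin (r / 2)) 0) => r0 [[]|[]] //.
apply: measurableU; first exact: mc.
apply: measurableI; first exact: measurableC.
have [AN|AN] := pselect (A None).
  suff -> : [set _ : R | A None] = setT by exact: measurableT.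
  by apply/seteqP; split.
suff -> : [set _ : R | A None] = set0 by exact: measurable0.
by apply/seteqP; split.
Qed.

Lemma lebesgue_period_lty :
  (@lebesgue_measure R [set` `[(0 : R), 2 * pi[%R] < +oo)%E.
Proof. by rewrite lebesgue_measure_itv /=; case: ifP => // _; rewrite ltry. Qed.

Definition period_measure :
    {finite_measure set (measurableTypeR R) -> \bar R} :=
  @mfrestr _ (measurableTypeR R) R _ lebesgue_measure
    (measurable_itv `[(0 : R), 2 * pi[%R) lebesgue_period_lty.

(* The measure d rho, each point of P1 having one angular coordinate rho in
   [0, 2 pi[. *)
Definition angle_measure : set (P1 R) -> \bar R :=
  pushforward period_measure angular.

Let pushed : {measure set (P1 R) -> \bar R} :=
  measure_function_pushforward__canonical__measure_function_Measure
    period_measure measurable_angular.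

Let angle_measure0 : angle_measure set0 = 0%E.
Proof. exact: (measure0 pushed). Qed.

Let angle_measure_ge0 A : (0 <= angle_measure A)%E.
Proof. exact: (measure_ge0 pushed). Qed.

Let angle_measure_sigma_additive : semi_sigma_additive angle_measure.
Proof. exact: (@measure_semi_sigma_additive _ _ _ pushed). Qed.

HB.instance Definition _ := isMeasure.Build _ _ _ angle_measure
  angle_measure0 angle_measure_ge0 angle_measure_sigma_additive.

Let angle_measure_fin : fin_num_fun angle_measure.
Proof.
move=> A mA; apply: fin_num_measure; rewrite -[X in measurable X]setTI.
exact: measurable_angular.
Qed.

HB.instance Definition _ :=
  Measure_isFinite.Build _ _ _ angle_measure angle_measure_fin.

End projective_line.

Section little_groups.
Variable R : realType.

Local Notation mat := 'M[R]_2.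

Definition torus_measure : set (P1 R * P1 R) -> \bar R :=
  (@angle_measure R \x @angle_measure R)%E.

HB.instance Definition _ := Measure.on torus_measure.

(* Representatives of the elements of the Hilbert space: two of them stand for
   the same vector when they agree almost everywhere. *)
Definition L2_torus : set (P1 R * P1 R -> R) :=
  [set f | f \in Lfun torus_measure 2%:E].

(* For g = (a b; c d), x g = (x a + c) / (x b + d), extended to x = oo. *)
Definition mobius (g : mat) (x : P1 R) : P1 R :=
  match x with
  | Some t =>
      if t * g 0 1 + g 1 1 == 0 then None
      else Some ((t * g 0 0 + g 1 0) / (t * g 0 1 + g 1 1))
  | None => if g 0 1 == 0 then None else Some (g 0 0 / g 0 1)
  end.

(* At oo, the value is the limit for x --> oo. *)
Definition kfac (g : mat) (x : P1 R) : R :=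
  match x with
  | Some t =>
      Num.sqrt (((t * g 0 1 + g 1 1) ^+ 2 + (t * g 0 0 + g 1 0) ^+ 2)
                / (1 + t ^+ 2))
  | None => Num.sqrt (g 0 1 ^+ 2 + g 0 0 ^+ 2)
  end.

(* The value is meaningless at the points oo and - d / b, where the sign jumps;
   these form a null set. *)
Definition sfac (g : mat) (x : P1 R) : R :=
  match x with
  | Some t => (t * g 0 1 + g 1 1) / `|t * g 0 1 + g 1 1|
  | None => g 0 1 / `|g 0 1|
  end.

Definition T' (gh : mat * mat) (phi : P1 R * P1 R -> R) : P1 R * P1 R -> R :=
  fun xy =>
    kfac gh.1 xy.1 ^- 3 * sfac gh.1 xy.1 *
    kfac gh.2 xy.2 ^- 3 * sfac gh.2 xy.2 *
    phi (mobius gh.1 xy.1, mobius gh.2 xy.2).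

Definition rotation (theta : R) : mat :=
  \matrix_(i, j)
    (if i == j then cos theta
     else if i == 0 then sin theta else - sin theta).

Definition SO2 : set mat := [set g | g *m g^T = 1%:M /\ \det g = 1].

Definition Cgroup (n : nat) : set mat :=
  [set rotation (2 * pi * r%:R / n%:R) | r in `I_n].

(* The operations are those of the product ring: componentwise matrix product
   and matrix inverse. *)
Definition is_subgroup (F : set (mat * mat)) : Prop :=
  [/\ F 1, (forall g h, F g -> F h -> F (g * h)) & (forall g, F g -> F g^-1)].

Definition subgroup_of (G F : set (mat * mat)) : Prop :=
  is_subgroup F /\ F `<=` G.

Definition invariants (F : set (mat * mat)) : set (P1 R * P1 R -> R) :=
  [set f | L2_torus f /\ forall h, F h -> T' h f = f %[ae torus_measure]].

Definition potential_little_group (F : set (mat * mat)) : Prop :=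
  [/\ subgroup_of (SO2 `*` SO2) F,
      exists2 f, invariants F f & ~ (f = cst 0 %[ae torus_measure])
    & ~ exists F', [/\ subgroup_of (SO2 `*` SO2) F', F `<` F'
                     & invariants F' = invariants F]].

Definition Dgroup : set (mat * mat) :=
  [set (1, 1); (-1, 1); (1, -1); (-1, -1)].

Definition class_E1 (F : set (mat * mat)) : Prop :=
  [/\ subgroup_of (SO2 `*` SO2) F, [set (1, 1); (-1, -1)] `<=` F
    & ~ (Dgroup `<=` F)].

End little_groups.

(* Main.v *)
Require Import Defs.
From mathcomp Require Import all_boot all_order all_algebra.
From mathcomp Require Import all_classical all_reals all_analysis.
From mathcomp Require Import measurable_realfun ess_sup_inf ring lra.

(** In the angles u = rho / 2 and v = sigma / 2, and after multiplication by
    the signs of sin u and sin v, a vector of H(P) becomes a function Psi(u, v)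
    that changes sign when u or v is shifted by pi, and the pair of rotations
    of angles (alpha, beta) acts by Psi(u, v) |-> Psi(u + alpha, v + beta).
    Two facts follow at once. The element (-I, -I) acts trivially, so adjoining
    it to F never changes the invariant vectors: a potential little group
    contains it (potential_class_E1). The element (-I, I) acts by -1, so a
    group containing it has no nonzero invariant vector (T'_N11).

    Conversely, let F be finite, contain (-I, -I) and not contain D; then F
    contains neither (-I, I) nor (I, -I). It is enough to produce, for every
    g outside F, an F-invariant vector moved by g (separating_invariant): no
    larger group then has the same invariants, and g = (-I, I) yields a nonzero
    invariant. Such a vector is the sum over h in F of the translates by h of
    Psi0(u, v) = S (sin u * sin v), where S is an odd continuous function with
    S 1 > 0 that vanishes on [-q, q]. Evaluate at u = v = pi / 2. The sum itself
    has the terms S (cos alpha * cos beta) for (alpha, beta) in F; a cosine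
    product equal to -1 would mean that (-I, I) or (I, -I) is in F, so for q
    close enough to 1 every term is nonnegative, and the identity of F makes
    the sum positive. The transform by g has the same terms taken over the coset
    g F, where a cosine product equal to 1 would put g in F; so it is at most 0
    there. By continuity the two functions differ on an open set, which has
    positive measure (averaged_bump_neq_ae).

    Everything is computed with matrix entries instead of angles: for x = t
    finite, the row (t, 1) / sqrt (1 + t ^ 2) is (cos u, sin u), and the second
    entry of its product with g is the function half_sine g below. *)

Set Implicit Arguments.
Unset Strict Implicit.
Unset Printing Implicit Defensive.

Import Order.TTheory GRing.Theory Num.Theory.
Import numFieldNormedType.Exports.

Local Open Scope classical_set_scope.
Local Open Scope ring_scope.

(** * Null sets and open sets of the torus *)

Section measure_on_P1.
Variable R : realType.
Local Notation mu := (@angle_measure R).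
Local Notation torus_mu := (@torus_measure R).

Lemma measurable_P1_set1 (x : P1 R) : measurable [set x].
Proof.
change (measurable ((@Some R) @^-1` [set x])); case: x => [t|].
  rewrite (_ : _ @^-1` _ = [set t]); first exact: measurable_set1.
  by apply/seteqP; split=> u /= => [[]|->].
rewrite (_ : _ @^-1` _ = set0); first exact: measurable0.
by apply/seteqP; split.
Qed.

(** Equal cotangents of r / 2 and s / 2 give sin ((r - s) / 2) = 0, while
    |r - s| / 2 < pi; the point oo is reached only where sin (r / 2) = 0. *)
Lemma angular_inj : {in `[0, 2 * pi[ &, injective (@angular R)}.
Proof.
move=> r s; rewrite !in_itv /= => /andP[r0 r2] /andP[s0 s2].
have half_gt0 (u : R) : 0 <= u -> u < 2 * pi -> sin (u / 2) = 0 -> u = 0.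
  move=> u0 u2 su; apply/eqP; rewrite eq_le u0 andbT leNgt; apply/negP => ugt0.
  have : 0 < sin (u / 2) by apply: sin_gt0_pi; apply/andP; split; lra.
  by rewrite su ltxx.
rewrite /angular; case: eqP => [/(half_gt0 _ r0 r2) ->|/eqP sr].
  by case: eqP => [/(half_gt0 _ s0 s2) ->|].
case: eqP => // /eqP ss [/eqP]; rewrite eqr_div// => /eqP e.
have sB : sin ((r - s) / 2) = 0.
  rewrite (_ : (r - s) / 2 = r / 2 - s / 2); last by lra.
  by rewrite sinB e; ring.
apply/eqP; rewrite eq_le; apply/andP; split; rewrite leNgt; apply/negP => lt.
  have : 0 < sin ((r - s) / 2) by apply: sin_gt0_pi; apply/andP; split; lra.
  by rewrite sB ltxx.
have : 0 < sin ((s - r) / 2) by apply: sin_gt0_pi; apply/andP; split; lra.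
by rewrite (_ : (s - r) / 2 = - ((r - s) / 2)) ?sinN ?sB ?oppr0 ?ltxx//; lra.
Qed.

Lemma angle_measureE (A : set (P1 R)) :
  mu A = lebesgue_measure (@angular R @^-1` A `&` [set` `[0, 2 * pi[]).
Proof. by []. Qed.

Lemma angle_measure_set1 (x : P1 R) : mu [set x] = 0%E.
Proof.
rewrite angle_measureE; have [[r]|] := pselect
  (exists r, (@angular R @^-1` [set x] `&` [set` `[0, 2 * pi[]) r).
  move=> rx; rewrite (_ : _ `&` _ = [set r]) ?lebesgue_measure_set1//.
  apply/seteqP; split=> s /=; last by move=> ->.
  move: rx => /= [rx rI] [sx sI].
  by apply: angular_inj => //; rewrite sx rx.
move=> nx; rewrite (_ : _ `&` _ = set0) ?measure0//.
by apply/seteqP; split=> r // rx; apply: nx; exists r.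
Qed.

Lemma ae_neq_P1 (x : P1 R) : \forall y \ae mu, y <> x.
Proof.
exists [set x]; split; [exact: measurable_P1_set1|exact: angle_measure_set1|].
by move=> y /= /contrapT.
Qed.

Lemma torus_measureX (A B : set (P1 R)) : measurable A -> measurable B ->
  torus_mu (A `*` B) = (mu A * mu B)%E.
Proof. by move=> mA mB; exact: product_measure1E. Qed.

Lemma ae_torus (P Q : P1 R -> Prop) :
  (\forall x \ae mu, P x) -> (\forall y \ae mu, Q y) ->
  \forall xy \ae torus_mu, P xy.1 /\ Q xy.2.
Proof.
move=> [A [mA A0 PA]] [B [mB B0 QB]].
have nA : torus_mu.-negligible (A `*` setT).
  apply/negligibleP; first exact: measurableX.
  by apply: etrans (torus_measureX mA measurableT) _; rewrite A0 mul0e.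
have nB : torus_mu.-negligible (setT `*` B).
  apply/negligibleP; first exact: measurableX.
  by apply: etrans (torus_measureX measurableT mB) _; rewrite B0 mule0.
apply: (negligibleS _ (negligibleU nA nB)) => -[x y] /= /not_andP[nP|nQ].
  by left; split => //; apply: PA.
by right; split => //; apply: QB.
Qed.

Definition P1_ball (e : R) : set (P1 R) := @Some R @` ball 0 e.

Lemma measurable_P1_ball (e : R) : measurable (P1_ball e).
Proof.
change (measurable ((@Some R) @^-1` P1_ball e)).
rewrite (_ : _ @^-1` _ = ball (0 : R) e); first exact: measurable_ball.
by apply/seteqP; split=> u /= => [[v ? [<-]]|?] //; exists u.
Qed.

(** The angular coordinate of the point 0 is pi, where cot (rho / 2) is
    continuous: an interval around pi is mapped into the ball. *)
Lemma angle_measure_ball_gt0 (e : R) : 0 < e -> (0 < mu (P1_ball e))%E.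
Proof.
move=> e0.
have pi0 : 0 < pi :> R := pi_gt0 R.
have ch : continuous ( *%R^~ 2^-1 : R -> R) by exact: mulrr_continuous.
have cs : continuous (fun r : R => sin (r / 2)).
  by move=> x; exact: (cvg_comp _ _ (ch x) (@continuous_sin R (x / 2))).
have cc : continuous (fun r : R => cos (r / 2)).
  by move=> x; exact: (cvg_comp _ _ (ch x) (@continuous_cos R (x / 2))).
have spi : sin (pi / 2) = 1 :> R by rewrite sin_pihalf.
have ccot : {for pi, continuous (fun r : R => cos (r / 2) / sin (r / 2))}.
  by apply: cvgM; [exact: cc|apply: cvgV; [rewrite spi oner_neq0|exact: cs]].
have nse : \forall r \near (pi : R), sin (r / 2) != 0.
  have : nbhs (sin (pi / 2) : R) [set x | x != 0].
    by apply: open_nbhs_nbhs; split; [exact: open_neq|rewrite /= spi oner_neq0].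
  by move/(cs pi).
have nce : \forall r \near (pi : R), ball 0 e (cos (r / 2) / sin (r / 2)).
  have : nbhs (cos (pi / 2) / sin (pi / 2) : R) (ball 0 e).
    by rewrite cos_pihalf mul0r; exact: nbhsx_ballx.
  by move/ccot.
have nI : \forall r \near (pi : R), r \in `[0, 2 * pi[.
  have /near_in_itvoo : (pi : R) \in `]0, 2 * pi[ by rewrite in_itv /=; lra.
  by apply: filterS => r; rewrite !in_itv /= => /andP[/ltW -> ->].
have : \forall r \near (pi : R),
    (@angular R @^-1` P1_ball e `&` [set` `[0, 2 * pi[]) r.
  near=> r; split => /=; last by near: r.
  have rs : sin (r / 2) != 0 by near: r.
  rewrite /angular (negbTE rs); exists (cos (r / 2) / sin (r / 2)) => //.
  by near: r.
move=> /nbhs_ballP[d /= d0 dS].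
rewrite angle_measureE.
apply: (@lt_le_trans _ _ (lebesgue_measure (ball (pi : R) d))).
  by rewrite lebesgue_measure_ball ?lte_fin ?ltW// mulrn_wgt0.
apply: le_measure => //; rewrite inE.
  exact: measurable_ball.
apply: measurableI => //; rewrite -[X in measurable X]setTI.
by apply: measurable_angular => //; exact: measurable_P1_ball.
Unshelve. all: by end_near. Qed.

(** Every neighbourhood of (0, 0), read in the chart R x R, has positive
    measure, hence meets every set of full measure. *)
Lemma ae_torus_near (P : P1 R * P1 R -> Prop) (U : set (R * R)) :
  (\forall xy \ae torus_mu, P xy) -> nbhs (0, 0) U ->
  exists t, U t /\ P (Some t.1, Some t.2).
Proof.
move=> aeP /nbhs_ballP[e /= e0 eU]; apply: contrapT => nex.
pose B := P1_ball e; have mB : measurable B by exact: measurable_P1_ball.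
have : torus_mu.-negligible (B `*` B).
  apply: (negligibleS _ aeP) => -[_ _] /= [[t te <-] [u ue <-]] Ptu.
  by apply: nex; exists (t, u); split => //; exact: eU.
move/negligibleP => /(_ (measurableX mB mB)) BB0.
have : (0 < mu B * mu B)%E by rewrite mule_gt0// angle_measure_ball_gt0.
by rewrite -torus_measureX// [X in (_ < X)%E]BB0 ltxx.
Qed.

End measure_on_P1.
(** * An odd function vanishing around 0 *)

Section soft_threshold.
Variable R : realType.
Implicit Types (q c s : R).

(** Twice the difference between c and its projection onto [-q, q]; the closed
    form in absolute values makes oddness and continuity immediate. *)
Definition soft_threshold q c : R := 2 * c - `|c + q| + `|c - q|.

Lemma soft_thresholdN q c : soft_threshold q (- c) = - soft_threshold q c.
Proof.
rewrite /soft_threshold (_ : - c + q = - (c - q)); last by ring.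
by rewrite (_ : - c - q = - (c + q)) ?normrN; ring.
Qed.

Lemma soft_threshold_sign q s c : s = 1 \/ s = -1 ->
  soft_threshold q (s * c) = s * soft_threshold q c.
Proof. by case=> ->; rewrite ?mul1r// !mulN1r soft_thresholdN. Qed.

Lemma soft_threshold1 q : 0 <= q < 1 -> 0 < soft_threshold q 1.
Proof.
by move=> /andP[q0 q1]; rewrite /soft_threshold !ger0_norm; lra.
Qed.

Lemma soft_threshold_eq0 q c : `|c| <= q -> soft_threshold q c = 0.
Proof.
rewrite ler_norml => /andP[c1 c2].
by rewrite /soft_threshold ger0_norm ?ler0_norm; lra.
Qed.

Lemma norm_soft_threshold_le q c : `|soft_threshold q c| <= 4 * `|c|.
Proof.
rewrite /soft_threshold -addrA (le_trans (ler_normD _ _))// normrM ger0_norm//.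
have -> : - `|c + q| + `|c - q| = `|c - q| - `|- c - q|.
  by rewrite -opprD normrN addrC.
have : `|(`|c - q| - `|- c - q|)| <= 2 * `|c|.
  rewrite (le_trans (ler_dist_dist _ _))//.
  rewrite (_ : c - q - (- c - q) = 2 * c); last by ring.
  by rewrite normrM ger0_norm.
lra.
Qed.

Lemma soft_threshold_continuous q : continuous (soft_threshold q).
Proof.
move=> c; apply: cvgD; first apply: cvgB.
- by apply: cvgM; [exact: cvg_cst|exact: cvg_id].
- by apply: cvg_norm; apply: cvgD; [exact: cvg_id|exact: cvg_cst].
- by apply: cvg_norm; apply: cvgB; [exact: cvg_id|exact: cvg_cst].
Qed.

(** A finite set of numbers leaves a gap below modulus 1: this provides a
    threshold q that kills all the values of modulus less than 1. *)
Lemma modulus_gap (E : seq R) :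
  exists2 q, 0 <= q < 1 & {in E, forall c, `|c| < 1 -> `|c| <= q}.
Proof.
elim: E => [|c E [q /andP[q0 q1] qE]].
  by exists 0 => //; rewrite lexx ltr01.
have [c1|c1] := ltP `|c| 1; last first.
  exists q; first by rewrite q0.
  by move=> d; rewrite inE => /predU1P[->|/qE//]; rewrite ltNge c1.
exists (Num.max q `|c|); first by rewrite le_max q0 gt_max q1.
move=> d; rewrite inE => /predU1P[->|/qE dq] d1; rewrite le_max ?lexx ?orbT//.
by rewrite dq.
Qed.

End soft_threshold.

(** * Rotation matrices *)

Section rotations.
Variable R : realType.
Local Notation mat := 'M[R]_2.
Implicit Types (g h : mat) (x : P1 R).

Lemma ord2P (i : 'I_2) : i = 0 \/ i = 1.
Proof. by case: i => -[|[|//]] ?; [left|right]; apply: val_inj. Qed.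

Lemma eq_mx2 g h : g 0 0 = h 0 0 -> g 0 1 = h 0 1 -> g 1 0 = h 1 0 ->
  g 1 1 = h 1 1 -> g = h.
Proof.
move=> e00 e01 e10 e11; apply/matrixP => i j.
by case: (ord2P i) => ->; case: (ord2P j) => ->.
Qed.

Lemma mul_mx2E g h i j : (g * h) i j = g i 0 * h 0 j + g i 1 * h 1 j.
Proof.
rewrite mxE !big_ord_recl big_ord0 addr0.
have -> : lift ord0 ord0 = 1 :> 'I_2 by exact: val_inj.
by have -> : ord0 = 0 :> 'I_2 by exact: val_inj.
Qed.

Lemma det_mx22 g : \det g = g 0 0 * g 1 1 - g 0 1 * g 1 0.
Proof.
rewrite (expand_det_row g 0) !big_ord_recl big_ord0 addr0 /cofactor !det_mx11.
rewrite !mxE /= expr0 expr1 mul1r mulN1r mulrN.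
congr (_ * _ - _ * _); congr (g _ _); apply: val_inj => //.
Qed.

(** For rows (a, b) and (c, d), (a - d)^2 + (b + c)^2 is the sum of the squared
    norms of the rows minus twice the determinant, that is 1 + 1 - 2. *)
Lemma SO2_entries g : SO2 g ->
  [/\ g 1 1 = g 0 0, g 1 0 = - g 0 1 & g 0 0 ^+ 2 + g 0 1 ^+ 2 = 1].
Proof.
move=> [gg]; rewrite det_mx22 => dg.
have e i j : g i 0 * g j 0 + g i 1 * g j 1 = (i == j)%:R.
  by have /matrixP/(_ i j) := gg; rewrite -[_ *m _]/(g * g^T) mul_mx2E !mxE.
have := e 0 0; have := e 0 1; have := e 1 1; rewrite !eqxx /= => e1 e2 e3.
have : (g 1 1 - g 0 0) ^+ 2 + (g 1 0 + g 0 1) ^+ 2 = 0.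
  rewrite (_ : _ + _ = (g 1 0 * g 1 0 + g 1 1 * g 1 1) +
    (g 0 0 * g 0 0 + g 0 1 * g 0 1) - 2 * (g 0 0 * g 1 1 - g 0 1 * g 1 0)).
    by rewrite e1 e3 dg; ring.
  by ring.
move/eqP; rewrite paddr_eq0 ?sqr_ge0// !sqrf_eq0 subr_eq0 addr_eq0.
by move=> /andP[/eqP -> /eqP ->]; split=> //; rewrite !expr2.
Qed.

Lemma SO2_unit g : SO2 g -> g \is a GRing.unit.
Proof.
by move=> [gg _]; have [] := mulmx1_unit gg.
Qed.

Lemma SO2M g h : SO2 g -> SO2 h -> SO2 (g * h).
Proof.
move=> [gg dg] [hh dh]; split; last by rewrite -mulmxE det_mulmx dg dh mulr1.
by rewrite -!mulmxE trmx_mul mulmxA -(mulmxA g) hh mulmx1.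
Qed.

Lemma SO2N g : SO2 g -> SO2 (- g).
Proof.
move=> [gg dg]; split; first by rewrite linearN /= mulmxN mulNmx opprK.
by rewrite -scaleN1r detZ dg sqrrN expr1n mulr1.
Qed.

Lemma SO2_1 : SO2 (1 : mat).
Proof. by split; [rewrite trmx1 mulmx1|exact: det1]. Qed.

Lemma SO2_eq g h : SO2 g -> SO2 h -> g 1 1 = h 1 1 -> g 0 1 = h 0 1 -> g = h.
Proof.
by move=> /SO2_entries[g1 g2 _] /SO2_entries[h1 h2 _] e1 e2; apply: eq_mx2;
  rewrite -?g1 -?h1 ?g2 ?h2 ?e1 ?e2.
Qed.

Lemma SO2_norm_le1 g : SO2 g -> `|g 1 1| <= 1.
Proof.
move=> /SO2_entries[-> _ e]; rewrite -(@ler_pXn2r _ 2) ?nnegrE//.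
by rewrite real_normK ?num_real// expr1n -e lerDl sqr_ge0.
Qed.

Lemma SO2_eq1 g : SO2 g -> g 1 1 = 1 -> g = 1.
Proof.
move=> sg g1; apply: SO2_eq SO2_1 _ _ => //; rewrite ?g1 ?mxE//=.
have [e _] := SO2_entries sg; rewrite -e g1 expr1n => /eqP.
by rewrite -subr_eq0 addrC addKr sqrf_eq0 => /eqP.
Qed.

Lemma SO2_eqN1 g : SO2 g -> g 1 1 = -1 -> g = -1.
Proof.
move=> sg g1; apply/eqP; rewrite -eqr_oppLR; apply/eqP.
by apply: SO2_eq1; [exact: SO2N|rewrite mxE g1 opprK].
Qed.

Lemma SO2_rotation (t : R) : SO2 (rotation t).
Proof.
split; last first.
  by rewrite det_mx22 !mxE /= mulrN opprK -!expr2 cos2Dsin2.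
apply: eq_mx2; rewrite -[_ *m _]/(_ * _) mul_mx2E !mxE /=.
- by rewrite -!expr2 cos2Dsin2.
- by ring.
- by ring.
- by rewrite mulrNN -!expr2 addrC cos2Dsin2.
Qed.

End rotations.

(** * Averaged bumps and the action on them *)

Section half_sine.
Variable R : realType.
Local Notation mat := 'M[R]_2.
Local Notation torus_mu := (@torus_measure R).
Implicit Types (g : mat) (x : P1 R).

(** For g the rotation of angle alpha and x = cot (rho / 2), this is
    sin (rho / 2 + alpha). The point oo carries no mass; the value 0 keeps the
    function bounded by 1. *)
Definition half_sine g x : R :=
  if x is Some t then (t * g 0 1 + g 1 1) / Num.sqrt (1 + t ^+ 2) else 0.

Lemma onePsqr_gt0 (t : R) : 0 < 1 + t ^+ 2.
Proof. by rewrite ltr_wpDr// sqr_ge0. Qed.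

Lemma half_sine0 g : half_sine g (Some 0) = g 1 1.
Proof. by rewrite /half_sine mul0r add0r expr0n addr0 sqrtr1 divr1. Qed.

Lemma SO2_sqr_cols g (t : R) : SO2 g ->
  (t * g 0 1 + g 1 1) ^+ 2 + (t * g 0 0 + g 1 0) ^+ 2 = 1 + t ^+ 2.
Proof.
move=> /SO2_entries[-> -> e].
transitivity ((1 + t ^+ 2) * (g 0 0 ^+ 2 + g 0 1 ^+ 2)); first by ring.
by rewrite e mulr1.
Qed.

Lemma half_sine_le1 g x : SO2 g -> `|half_sine g x| <= 1.
Proof.
move=> sg; case: x => [t|] /=; last by rewrite normr0.
rewrite normrM normfV (ger0_norm (sqrtr_ge0 _)).
rewrite ler_pdivrMr ?sqrtr_gt0 ?onePsqr_gt0//.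
by rewrite mul1r -sqrtr_sqr ler_wsqrtr// -(SO2_sqr_cols t sg) lerDl sqr_ge0.
Qed.

Lemma half_sine_continuous g : continuous (fun t : R => half_sine g (Some t)).
Proof.
move=> t; apply: cvgM.
  by apply: cvgD; [apply: cvgM; [exact: cvg_id|exact: cvg_cst]|exact: cvg_cst].
apply: cvgV; first by rewrite gt_eqF// sqrtr_gt0 onePsqr_gt0.
apply: continuous_comp; last exact: sqrt_continuous.
by apply: cvgD; [exact: cvg_cst|exact: exprn_continuous].
Qed.

Lemma measurable_half_sine g : measurable_fun [set: P1 R] (half_sine g).
Proof.
move=> _ A mA; rewrite setTI.
change (measurable ((fun t : R => half_sine g (Some t)) @^-1` A)).
rewrite -[X in measurable X]setTI.
by apply: continuous_measurable_fun => //; exact: half_sine_continuous.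
Qed.

(** The finite points with a finite image, that is almost all points; there
    the sign factor of g is 1 or -1. *)
Definition regular_point g x : Prop :=
  exists2 t : R, x = Some t & t * g 0 1 + g 1 1 != 0.

Lemma ae_regular_point g : SO2 g ->
  \forall x \ae @angle_measure R, regular_point g x.
Proof.
move=> sg; apply: filterS2 (ae_neq_P1 None)
  (ae_neq_P1 (Some (- g 1 1 / g 0 1))).
move=> [t|] // _ nt; exists t => //; apply/eqP => e; apply: nt; congr Some.
have [e01|n01] := eqVneq (g 0 1) 0; last first.
  by apply: (mulIf n01); rewrite divfK//; apply/eqP; rewrite -addr_eq0 e.
move: e; rewrite e01 mulr0 add0r => e.
have [e0 _] := SO2_entries sg.
by rewrite -e0 e e01 expr0n addr0 => /eqP; rewrite eq_sym oner_eq0.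
Qed.

Lemma kfac1 g x : SO2 g -> regular_point g x -> kfac g x = 1.
Proof.
move=> sg [t -> _] /=.
by rewrite SO2_sqr_cols// divff ?sqrtr1// gt_eqF// onePsqr_gt0.
Qed.

Lemma sfac_sign g x : regular_point g x -> sfac g x = 1 \/ sfac g x = -1.
Proof.
move=> [t -> n0] /=; case: (ltrgt0P (t * g 0 1 + g 1 1)) n0 => // c _.
  by left; rewrite divff// gt_eqF.
by right; rewrite invrN mulrN divff// lt_eqF.
Qed.

(** Both sides are the second entry of (t, 1) g h up to normalisation: the
    homogeneous coordinates (t, 1) g of x g have to be divided by their second
    entry, and the sign factor restores the sign lost in this division. *)
Lemma half_sine_mobius g (h : mat) x : SO2 g -> regular_point g x ->
  sfac g x * half_sine h (mobius g x) = half_sine (g * h) x.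
Proof.
move=> sg [t -> n0]; rewrite /sfac /mobius (negbTE n0) /half_sine.
have := SO2_sqr_cols t sg.
rewrite !mul_mx2E; set D := t * g 0 1 + g 1 1; set N := t * g 0 0 + g 1 0 => DN.
have D0 : D != 0 by [].
have -> : 1 + (N / D) ^+ 2 = (1 + t ^+ 2) / D ^+ 2.
  by rewrite -DN; field.
rewrite sqrtrM ?ltW ?onePsqr_gt0// sqrtrV ?sqr_ge0// sqrtr_sqr.
have s0 : Num.sqrt (1 + t ^+ 2) != 0 by rewrite gt_eqF// sqrtr_gt0 onePsqr_gt0.
have aD0 : `|D| != 0 by rewrite normr_eq0.
transitivity ((N * h 0 1 + D * h 1 1) / Num.sqrt (1 + t ^+ 2)).
  by field; rewrite s0 aD0 D0.
by congr (_ / _); rewrite /N /D; ring.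
Qed.

(** When s enumerates a finite group F, this is the sum over F of the translates
    of S (sin u * sin v), S being the soft threshold. *)
Definition averaged_bump (q : R) (s : seq (mat * mat)) (xy : P1 R * P1 R) : R :=
  \sum_(h <- s) soft_threshold q (half_sine h.1 xy.1 * half_sine h.2 xy.2).

Lemma averaged_bump0 q s : averaged_bump q s (Some 0, Some 0) =
  \sum_(h <- s) soft_threshold q (h.1 1 1 * h.2 1 1).
Proof.
by apply: eq_bigr => h _; rewrite -[h.1 1 1]half_sine0 -[h.2 1 1]half_sine0.
Qed.

(** The translate by h of the bump goes to its translate by g h; the sign
    factors pass through the soft threshold because it is odd. *)
Lemma averaged_bump_T' q s (g : mat * mat) : SO2 g.1 -> SO2 g.2 ->
  T' g (averaged_bump q s) =
    averaged_bump q [seq g * k | k <- s] %[ae torus_mu].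
Proof.
move=> sg1 sg2.
apply: filterS (ae_torus (ae_regular_point sg1) (ae_regular_point sg2)).
move=> [x y] /= [rx ry] _; rewrite /T' /averaged_bump /= !kfac1// !expr1n.
rewrite invr1 !mul1r mulr1.
rewrite big_map mulr_sumr; apply: eq_bigr => h _ /=.
rewrite -soft_threshold_sign; last first.
  by case: (sfac_sign rx) => ->; case: (sfac_sign ry) => ->;
    rewrite ?mulrNN ?mulr1 ?mul1r; auto.
by rewrite mulrACA !half_sine_mobius.
Qed.

Lemma averaged_bump_continuous q s :
  continuous (fun t : R * R => averaged_bump q s (Some t.1, Some t.2)).
Proof.
elim: s => [|h s IH] t.
  rewrite /averaged_bump; under eq_fun do rewrite big_nil.
  exact: cvg_cst.
rewrite /averaged_bump; under eq_fun do rewrite big_cons.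
apply: cvgD; last exact: IH.
pose u (k : mat) (a : R) := half_sine k (Some a).
have uc k : continuous (u k) by exact: half_sine_continuous.
have pc : {for t, continuous (fun t : R * R => u h.1 t.1 * u h.2 t.2)}.
  apply: cvgM.
    exact: (@continuous_comp _ _ _ fst (u h.1) t (@cvg_fst _ _ _ _ _)
      (@uc _ _)).
  exact: (@continuous_comp _ _ _ snd (u h.2) t (@cvg_snd _ _ _ _ _) (@uc _ _)).
exact: (@continuous_comp _ _ _ _ (soft_threshold q) t pc
  (@soft_threshold_continuous R q _)).
Qed.

Lemma measurable_averaged_bump q s :
  measurable_fun [set: P1 R * P1 R] (averaged_bump q s).
Proof.
apply: measurable_sum => h.
apply: (measurableT_comp
  (continuous_measurable_fun (@soft_threshold_continuous R q))).
apply: measurable_funM.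
  by apply: (measurableT_comp (measurable_half_sine _)); exact: measurable_fst.
by apply: (measurableT_comp (measurable_half_sine _)); exact: measurable_snd.
Qed.

Lemma bounded_L2_torus (f : P1 R * P1 R -> R) (M : R) :
  measurable_fun setT f -> (forall xy, `|f xy| <= M) -> L2_torus f.
Proof.
move=> mf fM; rewrite /L2_torus /=.
apply: (@Lfun_subset _ _ _ _ 2%:E +oo%E) => //; rewrite ?lee_fin ?ler1n ?leey//.
- have : torus_mu (setT `*` setT) \is a fin_num.
    by rewrite torus_measureX// fin_numM// fin_num_measure.
  by rewrite setXTT.
- rewrite inE; apply/andP; split; rewrite inE//= /finite_norm unlock /Lnorm.
  case: ifPn => [_|_]; last exact: ltry.
  apply: (@le_lt_trans _ _ M%:E); last exact: ltry.
  by apply: ess_sup_ler => xy; rewrite lee_fin.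
Qed.

Lemma averaged_bump_L2 q s : (forall h, h \in s -> SO2 h.1 /\ SO2 h.2) ->
  L2_torus (averaged_bump q s).
Proof.
move=> sS; apply: (@bounded_L2_torus _ (\sum_(h <- s) 4)) => [|[x y]].
  exact: measurable_averaged_bump.
rewrite (le_trans (ler_norm_sum _ _ _))// big_seq [leRHS]big_seq.
apply: ler_sum => h /sS[s1 s2] /=.
rewrite (le_trans (norm_soft_threshold_le _ _))// -[leRHS]mulr1 ler_wpM2l//.
by rewrite normrM mulr_ile1// half_sine_le1.
Qed.

Lemma averaged_bump_neq_ae q s s' :
  averaged_bump q s (Some 0, Some 0) != averaged_bump q s' (Some 0, Some 0) ->
  ~ (averaged_bump q s = averaged_bump q s' %[ae torus_mu]).
Proof.
move=> ne aeq.
have : \forall t \near ((0, 0) : R * R),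
    averaged_bump q s (Some t.1, Some t.2) -
    averaged_bump q s' (Some t.1, Some t.2) != 0.
  have c : {for ((0, 0) : R * R), continuous (fun t : R * R =>
      averaged_bump q s (Some t.1, Some t.2) -
      averaged_bump q s' (Some t.1, Some t.2))}.
    by apply: cvgB; exact: averaged_bump_continuous.
  apply: (c [set x | x != 0]); apply: open_nbhs_nbhs; split.
    exact: open_neq.
  by rewrite /= subr_eq0.
move=> /(ae_torus_near aeq)[t [/= ] + /(_ I) e].
by rewrite e subrr eqxx.
Qed.

End half_sine.

(** * Invariant vectors of subgroups *)

Section invariant_vectors.
Variable R : realType.
Local Notation mat := 'M[R]_2.
Local Notation torus_mu := (@torus_measure R).
Implicit Types (g h : mat * mat) (F : set (mat * mat)).

Lemma kfacN (a : mat) x : kfac (- a) x = kfac a x.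
Proof. by case: x => [t|] /=; rewrite !mxE ?mulrN -?opprD !sqrrN. Qed.

Lemma sfacN (a : mat) x : sfac (- a) x = - sfac a x.
Proof. by case: x => [t|] /=; rewrite !mxE ?mulrN -?opprD normrN mulNr. Qed.

Lemma mobiusN (a : mat) x : mobius (- a) x = mobius a x.
Proof.
case: x => [t|] /=; rewrite !mxE ?mulrN -?opprD oppr_eq0;
  by case: ifP => // _; rewrite invrN mulrNN.
Qed.

Lemma T'N g : T' (- g) = T' g.
Proof.
apply/funext => f; apply/funext => -[x y].
by rewrite /T' /= !kfacN !sfacN !mobiusN; ring.
Qed.

Lemma T'_N11 (f : P1 R * P1 R -> R) : T' (-1, 1) f = \- f %[ae torus_mu].
Proof.
apply: filterS (ae_torus (ae_neq_P1 None) (ae_neq_P1 None)).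
move=> [[t|] [u|]] [] //= _ _ _.
have k1 (v : R) : kfac 1 (Some v) = 1.
  apply: kfac1; first exact: SO2_1.
  by exists v; rewrite // !mxE /= mulr0 add0r oner_neq0.
have s1 (v : R) : sfac 1 (Some v) = 1.
  by rewrite /= !mxE /= mulr0 add0r normr1 divr1.
have m1 (v : R) : mobius 1 (Some v) = Some v.
  by rewrite /= !mxE /= mulr0 add0r oner_eq0 mulr1 addr0 divr1.
by rewrite /T' [(_, _).1]/= [(_, _).2]/= kfacN sfacN mobiusN !k1 !s1 !m1; field.
Qed.

Lemma SO2X_unit g : (@SO2 R `*` @SO2 R) g -> g \is a GRing.unit.
Proof. by move=> [s1 s2]; apply/andP; split; exact: SO2_unit. Qed.

(** Left multiplication by an element of F permutes the terms of the sum. *)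
Lemma subgroup_bump_invariant F (s : seq (mat * mat)) (q : R) :
  subgroup_of (@SO2 R `*` @SO2 R) F -> uniq s -> [set` s] = F ->
  invariants F (averaged_bump q s).
Proof.
move=> [[_ FM FV] FS] us sF.
have sP h : (h \in s) <-> F h by rewrite -sF.
split; first by apply: averaged_bump_L2 => h /sP/FS.
move=> g Fg; have [sg1 sg2] := FS _ Fg.
have ug := SO2X_unit (FS _ Fg).
apply: filterS (averaged_bump_T' q s sg1 sg2) => xy /(_ I) -> _.
apply: perm_big; apply: uniq_perm => //.
  by rewrite map_inj_uniq//; exact: mulrI.
move=> h; apply/mapP/idP => [[k /sP Fk ->]|/sP Fh].
  by apply/sP; exact: FM.
by exists (g^-1 * h); [apply/sP; apply: FM => //; exact: FV|rewrite mulVKr].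
Qed.

Lemma mul_unit_disk_eq1 (a b : R) : `|a| <= 1 -> `|b| <= 1 -> a * b = 1 ->
  (a = 1 /\ b = 1) \/ (a = -1 /\ b = -1).
Proof.
rewrite !ler_norml => /andP[a0 a1] /andP[b0 b1] e.
have /eqP : (a - b) ^+ 2 = 0 by apply/eqP; rewrite eq_le sqr_ge0 andbT; nra.
rewrite sqrf_eq0 subr_eq0 => /eqP ab; move: e; rewrite ab -expr2 => /eqP.
by rewrite sqrf_eq1 => /orP[] /eqP ->; [left|right].
Qed.

(** The product cos alpha * cos beta of the two rotation angles, at which the
    soft threshold is evaluated at the point (0, 0) of the chart. *)
Definition cos_cos g : R := g.1 1 1 * g.2 1 1.

Lemma cos_cos_le1 g : (@SO2 R `*` @SO2 R) g -> `|cos_cos g| <= 1.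
Proof. by move=> [s1 s2]; rewrite normrM mulr_ile1// SO2_norm_le1. Qed.

Lemma cos_cos_eq1 g : (@SO2 R `*` @SO2 R) g -> cos_cos g = 1 ->
  g = 1 \/ g = (-1, -1).
Proof.
case: g => a b [/= sa sb] /mul_unit_disk_eq1[]; rewrite ?SO2_norm_le1//.
  by move=> [/(SO2_eq1 sa) -> /(SO2_eq1 sb) ->]; left.
by move=> [/(SO2_eqN1 sa) -> /(SO2_eqN1 sb) ->]; right.
Qed.

Lemma cos_cos_eqN1 g : (@SO2 R `*` @SO2 R) g -> cos_cos g = -1 ->
  g = (-1, 1) \/ g = (1, -1).
Proof.
case: g => a b [/= sa sb] c.
have : cos_cos (- a, b) = 1.
  by rewrite /cos_cos /= mxE mulNr -[_ * _]/(cos_cos (a, b)) c opprK.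
move/cos_cos_eq1; case; first by split => //; exact: SO2N.
  by move=> [/eqP + ->]; rewrite eqr_oppLR => /eqP ->; left.
by move=> [/oppr_inj -> ->]; right.
Qed.

(** Each of (-I, I) and (I, -I) is the product of the other with (-I, -I), so
    that together with (-I, -I) either of them generates D. *)
Lemma class_E1_notin F : class_E1 F -> ~ F (-1, 1) /\ ~ F (1, -1).
Proof.
move=> [[[F1 FM _] _] FN nD].
have {}FN : F (-1, -1) by apply: FN; right.
have mix : ~ (F (-1, 1) /\ F (1, -1)).
  by move=> [Fa Fb]; apply: nD => k [[[]|]|] ->.
split=> Fa; apply: mix; split=> //; have := FM _ _ Fa FN.
  rewrite (_ : _ * _ = (1, -1))//.
  by apply/pair_equal_spec; split; rewrite /= ?mulrNN ?mul1r.
rewrite (_ : _ * _ = (-1, 1))//.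
by apply/pair_equal_spec; split; rewrite /= ?mulrNN ?mul1r.
Qed.

(** The averaged bump of F is positive at the point (0, 0) of the chart, whereas
    its transform by g is at most 0 there. *)
Lemma separating_invariant F g : class_E1 F -> finite_set F ->
  (@SO2 R `*` @SO2 R) g -> ~ F g ->
  exists2 f, invariants F f & ~ (T' g f = f %[ae torus_mu]).
Proof.
move=> E1 /finite_seqP[r Fr] Sg nFg.
have [FG FN1 _] := E1; have [[F1 FM FV] FS] := FG.
have {}FN1 : F (-1, -1) by apply: FN1; right.
pose s := undup r; have us : uniq s by exact: undup_uniq.
have sF : [set` s] = F.
  by rewrite Fr; apply/seteqP; split=> h /=; rewrite mem_undup.
have sP h : (h \in s) <-> F h by rewrite -sF.
have [nFa nFb] := class_E1_notin E1.
have Sgh h : F h -> (@SO2 R `*` @SO2 R) (g * h).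
  by move=> /FS[]; case: Sg => *; split; exact: SO2M.
have [q q01 gap] := modulus_gap
  ([seq cos_cos h | h <- s] ++ [seq cos_cos (g * h) | h <- s]).
have gapr h : F h -> `|cos_cos h| < 1 -> `|cos_cos h| <= q.
  by move=> Fh; apply: gap; rewrite mem_cat map_f//; exact/sP.
have gapg h : F h -> `|cos_cos (g * h)| < 1 -> `|cos_cos (g * h)| <= q.
  move=> Fh; apply: gap; rewrite mem_cat; apply/orP; right.
  by apply: (map_f (fun h => cos_cos (g * h))); exact/sP.
exists (averaged_bump q s); first exact: subgroup_bump_invariant.
move=> Tg; have [Sg1 Sg2] := Sg.
have : averaged_bump q [seq g * k | k <- s] = averaged_bump q s %[ae torus_mu].
  by apply: filterS2 (averaged_bump_T' q s Sg1 Sg2) Tg => xy + + _ => <- // ->.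
apply: averaged_bump_neq_ae; rewrite lt_eqF// !averaged_bump0 big_map.
(* the transform by g: no element of g F has cosine product 1 *)
apply: (@le_lt_trans _ _ 0).
  rewrite big_seq; apply: sumr_le0 => h /sP Fh; rewrite -/(cos_cos (g * h)).
  have := cos_cos_le1 (Sgh _ Fh).
  rewrite le_eqVlt => /predU1P[|lt1]; last first.
    by rewrite soft_threshold_eq0// gapg.
  move=> /eqP; rewrite eqr_norml ler01 andbT => /orP[] /eqP c.
    suff : F g by [].
    have -> : g = (g * h) * h^-1.
      by rewrite mulrK// SO2X_unit//; exact: FS.
    apply: FM; last exact: FV.
    by case: (cos_cos_eq1 (Sgh _ Fh) c) => ->.
  by rewrite c soft_thresholdN oppr_le0 ltW// soft_threshold1.
(* the bump of F: its term at the identity is positive, the others are not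
   negative *)
have s1 : 1 \in s by exact/sP.
rewrite (bigD1_seq 1)//= !mxE /= mulr1 ltr_wpDr ?soft_threshold1//.
rewrite big_seq_cond; apply: sumr_ge0 => h /andP[/sP Fh _].
rewrite -/(cos_cos h).
have := cos_cos_le1 (FS _ Fh); rewrite le_eqVlt => /predU1P[|lt1]; last first.
  by rewrite soft_threshold_eq0// gapr.
move=> /eqP; rewrite eqr_norml ler01 andbT => /orP[] /eqP c.
  by rewrite c ltW// soft_threshold1.
by case: (cos_cos_eqN1 (FS _ Fh) c) => e; move: Fh; rewrite e.
Qed.

(** An invariant moved by (-I, I), which acts by -1, is nonzero; and an element
    of a larger group moves some invariant of F. *)
Lemma class_E1_potential F : class_E1 F -> finite_set F ->
  potential_little_group F.
Proof.
move=> E1 finF; have [FG FN1 nD] := E1; have [[F1 FM FV] FS] := FG.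
split => //.
  have S : (@SO2 R `*` @SO2 R) (-1, 1).
    by split; [exact: SO2N (SO2_1 R)|exact: SO2_1].
  have [nF _] := class_E1_notin E1.
  have [f If nf] := separating_invariant E1 finF S nF.
  exists f => // f0; apply: nf.
  apply: filterS2 (T'_N11 f) f0 => xy + + _ => -> // /(_ I) /= ->.
  by rewrite oppr0.
move=> [F' [[F'G F'S] [FF' nF'F] eqI]].
have [g [F'g nFg]] : exists g, F' g /\ ~ F g.
  by apply: contrapT => nex; apply: nF'F => g F'g; apply: contrapT => nFg;
    apply: nex; exists g.
have [f If nf] := separating_invariant E1 finF (F'S _ F'g) nFg.
by move: If; rewrite -eqI => -[_ /(_ _ F'g)].
Qed.

(** The group generated by F and (-I, -I). *)
Lemma adjoin_N1_subgroup F : subgroup_of (@SO2 R `*` @SO2 R) F ->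
  subgroup_of (@SO2 R `*` @SO2 R) [set h | F h \/ F (- h)].
Proof.
move=> [[F1 FM FV] FS]; split; last first.
  move=> h /= [/FS//|/FS[a b]]; rewrite -[h]opprK.
  by split; exact: SO2N.
split => /=; first by left.
  move=> g h [Fg|Fg] [Fh|Fh].
  - by left; exact: FM.
  - by right; rewrite -mulrN; exact: FM.
  - by right; rewrite -mulNr; exact: FM.
  - by left; rewrite -mulrNN; exact: FM.
by move=> g [/FV|/FV]; [left|right; rewrite -invrN].
Qed.

(** Without (-I, -I), F could be enlarged by it without losing an invariant; and
    an invariant of (-I, I), which lies in D, equals its own opposite. *)
Lemma potential_class_E1 F : potential_little_group F -> class_E1 F.
Proof.
move=> [FG [f [_ If] nf] maxF]; split => //; last first.
  move=> DF; apply: nf; have FN : F (-1, 1) by apply: DF; left; left; right.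
  apply: filterS2 (T'_N11 f) (If _ FN) => xy + + _ => /(_ I) -> /(_ I) /= e.
  by lra.
have [[F1 _ _] FS] := FG.
move=> _ [->//|->]; apply: contrapT => nFN; apply: maxF.
exists [set h | F h \/ F (- h)]; split; first exact: adjoin_N1_subgroup.
  split; first by move=> h; left.
  move=> sub; apply: nFN; apply: sub; right.
  have -> : - (-1, -1) = 1 :> mat * mat := opprK (1 : mat * mat).
  exact: F1.
apply/seteqP; split=> u [L2u Iu]; split=> // h.
  by move=> Fh; apply: Iu; left.
by move=> [/Iu//|/Iu]; rewrite T'N.
Qed.

Lemma finite_potentialP F :
  finite_set F -> (potential_little_group F <-> class_E1 F).
Proof.
by move=> finF; split=> [/potential_class_E1//|E1]; exact: class_E1_potential.
Qed.

End invariant_vectors.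

Lemma Cgroup_SO2 (R : realType) n : @Cgroup R n `<=` @SO2 R.
Proof. by move=> _ [k _ <-]; exact: SO2_rotation. Qed.

Lemma finite_Cgroup (R : realType) n : finite_set (@Cgroup R n).
Proof. exact/finite_image/finite_II. Qed.

Theorem proposition9 (R : realType) :
  (forall F : set ('M[R]_2 * 'M[R]_2),
     subgroup_of (@SO2 R `*` @SO2 R) F -> finite_set F ->
     (potential_little_group F <-> class_E1 F)) /\
  (forall (n m : nat) (F : set ('M[R]_2 * 'M[R]_2)),
     (0 < n)%N -> ~~ odd n -> (0 < m)%N -> ~~ odd m ->
     subgroup_of (@Cgroup R n `*` @Cgroup R m) F ->
     (potential_little_group F <->
      F (-1, -1) /\ ~ (@Dgroup R `<=` F))).
Proof.
split=> [F _|n m F _ _ _ _ [FG FC]]; first exact: finite_potentialP.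
have FS : subgroup_of (@SO2 R `*` @SO2 R) F.
  by split=> // h /FC[a b]; split;
    [exact: (Cgroup_SO2 a)|exact: (Cgroup_SO2 b)].
have finF : finite_set F.
  by apply: (sub_finite_set FC); apply: finite_setX; exact: finite_Cgroup.
rewrite finite_potentialP//; split=> [[_ FN nD]|[FN nD]].
  by split=> //; apply: FN; right.
by split=> // h [->|->] //; have [] := FG.
Qed.
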